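(* Let $k\in\mathbb{N}$ and $m\in\mathbb{N}$. For $j=1,\dots,m$ let $G_j=(V_j,E_j)$ be a finite weighted graph with edge weights $w^j$, vertex measure $\mu_j$ and $S^1_k$-valued signature $s^j$, and let $h(G_j)=h_1^{s^j}(\mu_j)$. Let $G_1\times\cdots\times G_m$ be their signed Cartesian product and $h(G_1\times\cdots\times G_m)=h_1^{s}(\mu)$ its Cheeger constant. Then $$\frac13\sum_{j=1}^m h(G_j)\le h(G_1\times\cdots\times G_m)\le 3\sum_{j=1}^m h(G_j).$$
   Context: A weighted graph: $G=(V,E)$ undirected simple finite, edge weights $w_{uv}=w_{vu}>0$, vertex measure $\mu:V\to(0,\infty)$; $|E(X,X^c)|=\sum_{u\in X,v\notin X}w_{uv}$, $\mathrm{vol}_\mu(X)=\sum_{u\in X}\mu(u)$. $S^1_k=\{e^{2\pi i j/k}:j=1,\dots,k\}$. A signature is $s:E^{or}\to S^1_k$ on oriented edges with $s_{vu}=s_{uv}^{-1}$. For nonempty $V_1\subseteq V$ with induced edge set $E_1$, $\iota^s(V_1)=\min_{\tau:V_1\to S^1_k}\sum_{\{u,v\}\in E_1}w_{uv}|\tau(u)-s_{uv}\tau(v)|$. The (one-way signed) Cheeger constant is $h_1^s(\mu)=\min_{\emptyset\neq V_1\subseteq V}\frac{\iota^s(V_1)+|E(V_1,V_1^c)|}{\mathrm{vol}_\mu(V_1)}$. Signed Cartesian product: vertex set $V_1\times\cdots\times V_m$; $(u_1,\dots,u_m)\sim(u_1',\dots,u_m')$ iff there is $j$ with $u_j\sim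 u_j'$ in $G_j$ and $u_i=u_i'$ for all $i\neq j$; such an edge has weight $w^j_{u_ju_j'}\prod_{i\neq j}\mu_i(u_i)$ and signature $s^j_{u_ju_j'}$; the vertex measure is $\mu=\mu_1\times\cdots\times\mu_m$. (For $m=2$ this is: weight $w^2_{vv'}\mu_1(u)$ on edges with $u=u'$, $v\sim v'$, and $w^1_{uu'}\mu_2(v)$ on edges with $v=v'$, $u\sim u'$; the general case is the iterated product.) *)

(* Defs.v *)
From HB Require Import structures.
From mathcomp Require Import all_boot all_order all_algebra.
From mathcomp Require Import complex.
From mathcomp Require Import reals trigo.

Set Implicit Arguments.
Unset Strict Implicit.
Unset Printing Implicit Defensive.

Import Order.TTheory GRing.Theory Num.Theory.

Local Open Scope ring_scope.
Local Open Scope complex_scope.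

Section Minimum.
Context {R : realType} {I : finType}.

(* Minimum of F over the indices satisfying P; it is 0, by convention, when
   there is no such index. *)
Definition fmin (P : pred I) (F : I -> R) : R :=
  if [pick i | P i] is Some i0 then F [arg min_(i < i0 | P i) F i]%O else 0.

Lemma fminP (P : pred I) (F : I -> R) (i0 : I) : P i0 ->
  (exists2 i, P i & fmin P F = F i) /\ (forall i, P i -> fmin P F <= F i).
Proof.
move=> Pi0; rewrite /fmin; case: pickP => [i1 Pi1|/(_ i0)]; last by rewrite Pi0.
by case: arg_minP => // i Pi le_i; split; [exists i|].
Qed.

End Minimum.

Section RootsOfUnity.
Variable R : realType.

(* exp (2 pi i j / k) *)
Definition expi2pi (k j : nat) : R[i] :=
  let t := 2 * pi * j%:R / k%:R in cos t +i* sin t.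

Definition S1 (k : nat) : seq R[i] := [seq expi2pi k j | j <- iota 1 k].

End RootsOfUnity.

(* The edges are given by a symmetric irreflexive relation, and the oriented
   edges are the pairs (u, v) with adj u v.  Only the values of wt and sg on
   such pairs are meaningful: they are arbitrary elsewhere. *)
Record sgraph (R : realType) (k : nat) := SGraph {
  vertex :> finType;
  vertex_gt0 : (0 < #|vertex|)%N;
  adj : rel vertex;
  adj_sym : symmetric adj;
  adj_irr : irreflexive adj;
  wt : vertex -> vertex -> R;
  wt_sym : forall u v, adj u v -> wt u v = wt v u;
  wt_gt0 : forall u v, adj u v -> 0 < wt u v;
  mu : vertex -> R;
  mu_gt0 : forall u, 0 < mu u;
  sg : vertex -> vertex -> R[i];
  sg_S1 : forall u v, adj u v -> sg u v \in S1 R k;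
  sg_inv : forall u v, adj u v -> sg v u = (sg u v)^-1
}.

Section Cheeger.
Context {R : realType} {k : nat}.
Variable G : sgraph R k.

Definition vol (A : {set G}) : R := \sum_(u in A) mu u.

Definition boundary (A : {set G}) : R :=
  \sum_(u in A) \sum_(v | (v \notin A) && adj u v) wt u v.

(* The sum over the unordered edges {u, v} inside A is half the sum over the
   ordered pairs (u, v): since sg v u = (sg u v)^-1 has modulus 1, the terms for
   (u, v) and (v, u) are equal. *)
Definition frustration (A : {set G}) (tau : G -> R[i]) : R :=
  2^-1 * \sum_(u in A) \sum_(v in A | adj u v)
           wt u v * Normc.normc (tau u - sg u v * tau v).

(* tau is taken on all of G, but only its restriction to A matters. *)
Definition frustration_index (A : {set G}) : R :=
  fmin predT (fun tau : {ffun G -> seq_sub (S1 R k)} =>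
                frustration A (fun u => val (tau u))).

Definition cheeger : R :=
  fmin (fun A : {set G} => A != set0)
       (fun A => (frustration_index A + boundary A) / vol A).

End Cheeger.

Section Product.
Context {R : realType} {k m : nat}.
Variable G : 'I_m -> sgraph R k.

Definition pvertex : finType := {dffun forall j : 'I_m, G j}.

Definition pstep (j : 'I_m) (u v : pvertex) : bool :=
  adj (u j) (v j) && [forall i, (i != j) ==> (u i == v i)].

Definition padj (u v : pvertex) : bool := [exists j, pstep j u v].

(* Adjacent tuples differ in exactly one coordinate, so there is only one j to
   pick; the default values concern non-adjacent tuples only. *)
Definition pwt (u v : pvertex) : R :=
  if [pick j | pstep j u v] is Some j
  then wt (u j) (v j) * \prod_(i | i != j) mu (u i) else 0.

Definition psg (u v : pvertex) : R[i] :=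
  if [pick j | pstep j u v] is Some j then sg (u j) (v j) else 1.

Definition pmu (u : pvertex) : R := \prod_i mu (u i).

Lemma pvertex_gt0 : (0 < #|pvertex|)%N.
Proof.
have x (j : 'I_m) : G j by exact: enum_val (Ordinal (vertex_gt0 (G j))).
by apply/card_gt0P; exists (finfun x).
Qed.

Lemma pstep_sym j : symmetric (pstep j).
Proof.
move=> u v; rewrite /pstep adj_sym; congr andb.
by apply: eq_forallb => i; rewrite [u i == _]eq_sym.
Qed.

Lemma pstep_uniq i j u v : pstep i u v -> pstep j u v -> i = j.
Proof.
move=> /andP[adj_i _] /andP[_ /forallP/(_ i)/implyP eq_i].
by apply: contraTeq adj_i => /eq_i/eqP->; rewrite adj_irr.
Qed.

Lemma padj_sym : symmetric padj.
Proof. by move=> u v; apply: eq_existsb => j; apply: pstep_sym. Qed.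

Lemma padj_irr : irreflexive padj.
Proof.
by move=> u; apply/negbTE/existsP => -[j /andP[]]; rewrite adj_irr.
Qed.

Lemma padjP u v : padj u v ->
  exists2 j, pstep j u v & [pick j | pstep j u v] = Some j.
Proof.
by case/existsP=> j uv; case: pickP => [i iuv|/(_ j)]; [exists i|rewrite uv].
Qed.

Lemma pickC u v : [pick j | pstep j v u] = [pick j | pstep j u v].
Proof. by apply: eq_pick => j; apply: pstep_sym. Qed.

Lemma pwt_sym u v : padj u v -> pwt u v = pwt v u.
Proof.
case/padjP=> j /andP[uv /forallP eq_uv] pickj.
rewrite /pwt (pickC u v) pickj wt_sym //; congr (_ * _).
by apply: eq_bigr => i ij; move/implyP: (eq_uv i) => /(_ ij)/eqP->.
Qed.

Lemma pwt_gt0 u v : padj u v -> 0 < pwt u v.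
Proof.
case/padjP=> j /andP[uv _] pickj; rewrite /pwt pickj mulr_gt0 ?wt_gt0 //.
by apply: prodr_gt0 => i _; apply: mu_gt0.
Qed.

Lemma pmu_gt0 u : 0 < pmu u.
Proof. by apply: prodr_gt0 => i _; apply: mu_gt0. Qed.

Lemma psg_S1 u v : padj u v -> psg u v \in S1 R k.
Proof. by case/padjP=> j /andP[uv _] pickj; rewrite /psg pickj sg_S1. Qed.

Lemma psg_inv u v : padj u v -> psg v u = (psg u v)^-1.
Proof.
by case/padjP=> j /andP[uv _] pickj; rewrite /psg (pickC u v) pickj sg_inv.
Qed.

Definition cart_prod : sgraph R k :=
  SGraph pvertex_gt0 padj_sym padj_irr pwt_sym pwt_gt0 pmu_gt0 psg_S1 psg_inv.

End Product.

(* Main.v *)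
(* The Cheeger constant of the product is in fact equal to the sum of the h(G_j).
   Every edge of the product moves a single coordinate, so the cost (frustration
   plus boundary) of a set A with a switching function tau is the sum over j of
   the weighted costs of the slices of A in direction j, while the volume of A is,
   for each j, the sum of the volumes of these slices with the same weights.  Each
   slice costs at least h(G_j) times its volume, which gives ">=".  If A is the
   product of optimal sets A_j and tau the product of optimal tau_j, every slice
   is empty or optimal, which gives "<=". *)
Require Import Defs.
From mathcomp Require Import all_boot all_order all_algebra.
From mathcomp Require Import complex lra.
From mathcomp Require Import reals trigo.

Import Order.TTheory GRing.Theory Num.Theory.

Local Open Scope ring_scope.

(** * Closure of the $k$-th roots of unity under products *)

Section RootsOfUnity.
Context {R : realType}.

Lemma expi2piD (k i j : nat) :
  expi2pi R k (i + j) = expi2pi R k i * expi2pi R k j.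
Proof.
rewrite /expi2pi natrD mulrDr mulrDl cosD sinD /=.
by rewrite /GRing.mul /=; congr (_ +i* _)%C; rewrite addrC [X in _ + X]mulrC.
Qed.

Lemma expi2pi_period {k : nat} : (0 < k)%N -> expi2pi R k k = 1.
Proof.
move=> k_gt0; rewrite /expi2pi mulfK ?pnatr_eq0 -?lt0n //.
by rewrite mulr_natl cos2pi sin2pi.
Qed.

Lemma normc_expi2pi (k j : nat) : Normc.normc (expi2pi R k j) = 1.
Proof. by rewrite /Normc.normc /expi2pi cos2Dsin2 sqrtr1. Qed.

Lemma normc_S1 {k : nat} {z : R[i]} : z \in S1 R k -> Normc.normc z = 1.
Proof. by case/mapP=> j _ ->; apply: normc_expi2pi. Qed.

Lemma S1_1 {k : nat} : (0 < k)%N -> 1 \in S1 R k.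
Proof.
move=> k_gt0; rewrite -(expi2pi_period k_gt0) map_f // mem_iota k_gt0.
by rewrite add1n leqnn.
Qed.

Lemma S1_mul {k : nat} {y z : R[i]} :
  y \in S1 R k -> z \in S1 R k -> y * z \in S1 R k.
Proof.
case/mapP=> i + -> /mapP[j + ->]; rewrite !mem_iota !add1n !ltnS.
move=> /andP[i_gt0 le_ik] /andP[j_gt0 le_jk]; rewrite -expi2piD.
(* Exponents must stay in $1,\dots,k$: when [i + j] exceeds [k], subtracting one period leaves a
   positive exponent, at most [k]. *)
have [le_ijk|lt_kij] := leqP (i + j) k.
  by rewrite map_f // mem_iota add1n ltnS le_ijk addn_gt0 i_gt0.
rewrite -(subnK (ltnW lt_kij)) expi2piD expi2pi_period ?(leq_trans i_gt0) //.
rewrite mulr1 map_f // mem_iota add1n ltnS subn_gt0 lt_kij leq_subLR.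
by rewrite leq_add.
Qed.

Lemma S1_prod {k : nat} {I : finType} (P : pred I) (F : I -> R[i]) : (0 < k)%N ->
  (forall i, F i \in S1 R k) -> \prod_(i | P i) F i \in S1 R k.
Proof.
by move=> k_gt0 FS1; elim/big_ind: _ => // [|y z]; [apply: S1_1|apply: S1_mul].
Qed.

End RootsOfUnity.

(** * Cost of a set with a switching function, and the Cheeger constant *)

Section Cost.
Context {R : realType} {k : nat} {G : sgraph R k}.
Implicit Types (A : {set G}) (tau : G -> R[i]).

Definition cost A tau : R := frustration A tau + boundary A.

(** Internal and boundary edges merge into one sum over the neighbours of [u], which can then be
    split by direction in a product. Each internal edge is still met from both ends, hence
    [2^-1]. *)
Lemma costE A tau :
  cost A tau = \sum_(u in A) \sum_(v | adj u v) wt u v *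
    (if v \in A then 2^-1 * Normc.normc (tau u - sg u v * tau v) else 1).
Proof.
rewrite /cost /frustration /boundary big_distrr /= -big_split /=.
apply: eq_bigr => u _; rewrite (bigID (fun v => v \in A) (adj u)) /=.
congr (_ + _).
  rewrite big_distrr /=; apply: eq_big => [v|v /andP[-> _]]; first exact: andbC.
  by rewrite mulrCA.
apply: eq_big => [v|v /andP[/negbTE-> _]]; first exact: andbC.
by rewrite mulr1.
Qed.

Lemma eq_cost A tau tau' : tau =1 tau' -> cost A tau = cost A tau'.
Proof.
move=> eq_tau; rewrite !costE; apply: eq_bigr => u _; apply: eq_bigr => v _.
by rewrite !eq_tau.
Qed.

Lemma cost_scale A tau (c : R[i]) : Normc.normc c = 1 ->
  cost A (fun u => c * tau u) = cost A tau.
Proof.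
move=> c1; rewrite !costE; apply: eq_bigr => u _; apply: eq_bigr => v _.
by rewrite mulrCA -mulrBr Normc.normcM c1 mul1r.
Qed.

Lemma cost_ge0 A tau : 0 <= cost A tau.
Proof.
rewrite costE; apply: sumr_ge0 => u _; apply: sumr_ge0 => v uv.
rewrite mulr_ge0 ?(ltW (wt_gt0 uv)) //; case: ifP => // _.
rewrite mulr_ge0 ?invr_ge0 ?ler0n //.
by case: (_ - _) => a b; apply: sqrtr_ge0.
Qed.

Lemma cost0 tau : cost set0 tau = 0.
Proof. by rewrite costE big_set0. Qed.

Lemma vol0 : vol (set0 : {set G}) = 0.
Proof. by rewrite /vol big_set0. Qed.

Lemma vol_gt0 A : A != set0 -> 0 < vol A.
Proof.
case/set0Pn=> u uA; rewrite /vol (big_setD1 u) //= ltr_pwDl ?mu_gt0 //.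
by apply: sumr_ge0 => v _; apply/ltW/mu_gt0.
Qed.

Hypothesis k_gt0 : (0 < k)%N.

Let tau1 : {ffun G -> seq_sub (S1 R k)} := [ffun=> SeqSub (S1_1 k_gt0)].

(** Both minima range over inhabited families, as [k] is positive and [G] has a vertex, so they are
    attained and the default value of [fmin] never occurs. *)
Lemma cheeger_witness : exists A tau,
  [/\ A != set0, forall u, tau u \in S1 R k & cost A tau = cheeger G * vol A].
Proof.
have setT_neq0 : [set: G] != set0 by rewrite -card_gt0 cardsT vertex_gt0.
have [[A A_neq0 hA] _] := fminP (P := fun A : {set G} => A != set0)
  (fun A => (frustration_index A + boundary A) / vol A) setT_neq0.
have [[tau _ iotaA] _] := fminP (P := predT)
  (fun tau : {ffun G -> seq_sub (S1 R k)} => frustration A (fun u => val (tau u)))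
  (i0 := tau1) isT.
exists A, (fun u => val (tau u)); split=> // [u|]; first exact: valP.
by rewrite /cheeger hA divfK ?gt_eqF ?vol_gt0 // /frustration_index iotaA.
Qed.

(** Clearing the denominator makes the bound hold for the empty set too, as is needed for slices
    that may be empty. *)
Lemma cheeger_le_cost A tau : (forall u, tau u \in S1 R k) ->
  cheeger G * vol A <= cost A tau.
Proof.
move=> tauS1; have [->|A_neq0] := eqVneq A set0; first by rewrite cost0 vol0 mulr0.
rewrite -ler_pdivlMr ?vol_gt0 //.
have [_ /(_ _ A_neq0)] := fminP (P := fun A : {set G} => A != set0)
  (fun A => (frustration_index A + boundary A) / vol A) A_neq0.
move/le_trans; apply; rewrite ler_pM2r ?invr_gt0 ?vol_gt0 // lerD2r.
pose t : {ffun G -> seq_sub (S1 R k)} := [ffun u => SeqSub (tauS1 u)].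
have [_ /(_ t isT)] := fminP (P := predT)
  (fun tau : {ffun G -> seq_sub (S1 R k)} => frustration A (fun u => val (tau u)))
  (i0 := t) isT.
move/le_trans; apply; rewrite le_eqVlt; apply/orP; left; apply/eqP.
(* Adding the boundary to both frustrations turns them into costs. *)
by apply: (addIr (boundary A)); apply: eq_cost => u; rewrite ffunE.
Qed.

Lemma cheeger_ge0 : 0 <= cheeger G.
Proof.
have [A [tau [A_neq0 _ cA]]] := cheeger_witness.
by rewrite -(pmulr_lge0 _ (vol_gt0 _ A_neq0)) -cA cost_ge0.
Qed.

End Cost.

(** * Decomposition of volume and cost along the lines of the product *)

Section Product.
Context {R : realType} {k m : nat} (G : 'I_m -> sgraph R k).
Implicit Types (u v : pvertex G) (A : {set cart_prod G}).

Definition upd u (j : 'I_m) (x : G j) : pvertex G :=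
  finfun (dfwith (fun i => u i) x).

Lemma upd_in u j x : upd u j x j = x.
Proof. by rewrite ffunE dfwith_in. Qed.

Lemma upd_out u j x i : i != j -> upd u j x i = u i.
Proof. by move=> ij; rewrite ffunE dfwith_out // eq_sym. Qed.

Lemma upd_eq u v j : (forall i, i != j -> u i = v i) -> upd u j (v j) = v.
Proof.
move=> uv; apply/ffunP => i.
by have [->|ij] := eqVneq i j; rewrite ?upd_in // upd_out ?uv.
Qed.

Lemma upd_upd u j x y : upd (upd u j x) j y = upd u j y.
Proof.
rewrite -[in RHS](upd_in (upd u j x) j y) upd_eq // => i ij.
by rewrite !upd_out.
Qed.

Definition cowt (j : 'I_m) u : R := \prod_(i | i != j) mu (u i).

Lemma cowt_ge0 j u : 0 <= cowt j u.
Proof. by apply: prodr_ge0 => i _; apply/ltW/mu_gt0. Qed.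

Lemma cowt_upd j u x : cowt j (upd u j x) = cowt j u.
Proof. by apply: eq_bigr => i ij; rewrite upd_out. Qed.

Lemma pmu_upd j u x : pmu (upd u j x) = cowt j u * mu x.
Proof.
by rewrite /pmu (bigD1 j) //= -/(cowt j _) cowt_upd upd_in mulrC.
Qed.

Lemma pick_pstep j u v : pstep j u v -> [pick i | pstep i u v] = Some j.
Proof.
by move=> uv; case: pickP => [i /pstep_uniq/(_ uv)->|/(_ j)]; rewrite ?uv.
Qed.

(* The involution [(u, x) |-> (upd u j x, u j)] replaces a choice of
   representatives for the lines in direction j by an average over all points. *)
Lemma sum_upd j (F : pvertex G -> R) :
  \sum_u F u = #|G j|%:R^-1 * \sum_u \sum_x F (upd u j x).
Proof.
have cardG : #|G j|%:R != 0 :> R by rewrite pnatr_eq0 -lt0n vertex_gt0.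
apply: (canRL (mulKf cardG)); rewrite pair_big /=.
pose swap (p : pvertex G * G j) := (upd p.1 j p.2, p.1 j).
have swapK : involutive swap.
  by case=> u x; rewrite /swap /= upd_in upd_upd upd_eq.
rewrite (reindex_inj (inv_inj swapK)) /=.
rewrite (eq_bigr (fun p => F p.1)) => [|[u x] _]; last by rewrite upd_upd upd_eq.
rewrite -(pair_big predT predT (fun u _ => F u)) /= mulr_sumr.
by apply: eq_bigr => u _; rewrite sumr_const mulr_natl.
Qed.

(** A neighbour of [u] is determined by the one coordinate that changes and its new value. [F] takes
    weight and signature as arguments so that the [pick] in [pwt] and [psg] is resolved here. *)
Lemma sum_padj u (F : pvertex G -> R -> R[i] -> R) :
  \sum_(v | padj u v) F v (pwt u v) (psg u v) =
  \sum_j \sum_(x | adj (u j) x)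
     F (upd u j x) (wt (u j) x * cowt j u) (sg (u j) x).
Proof.
pose f v := F v (pwt u v) (psg u v).
(* The inserted inner sum has a single term, the direction of the edge; the two sums can then be
   exchanged. *)
transitivity (\sum_(v | padj u v) \sum_(j | pstep j u v) f v).
  apply: eq_bigr => v /padjP[j uv _]; rewrite (big_pred1 j) // => i.
  by apply/idP/eqP => [/pstep_uniq/(_ uv)|->].
rewrite (exchange_big_dep predT) //=; apply: eq_bigr => j _.
rewrite (reindex_onto (upd u j) (fun v => v j)) /=; last first.
  move=> v /andP[_ /andP[_ /forallP uv]]; apply: upd_eq => i ij.
  by move/implyP: (uv i) => /(_ ij)/eqP.
have step x : pstep j u (upd u j x) = adj (u j) x.
  rewrite /pstep upd_in; case: (adj _ _) => //=.
  by apply/forallP => i; apply/implyP => ij; rewrite upd_out.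
apply: eq_big => [x|x /andP[/andP[_ uv] _]].
  rewrite upd_in eqxx andbT step andb_idl // => ux.
  by apply/existsP; exists j; rewrite step.
by rewrite /f /pwt /psg (pick_pstep _ _ _ uv) upd_in.
Qed.

(** Indexing by a full tuple [u], whose coordinate [j] is ignored, counts each line [#|G j|] times;
    the factor [#|G j|%:R^-1] below compensates. *)
Definition slice A u (j : 'I_m) : {set G j} := [set x | upd u j x \in A].

Lemma vol_slices A j :
  vol A = #|G j|%:R^-1 * \sum_u cowt j u * vol (slice A u j).
Proof.
rewrite /vol big_mkcond (sum_upd j) /=; congr (_ * _); apply: eq_bigr => u _.
rewrite mulr_sumr [RHS]big_mkcond; apply: eq_bigr => x _.
by rewrite inE -pmu_upd.
Qed.

Lemma cost_slices A (tau : pvertex G -> R[i]) :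
  cost A tau = \sum_j #|G j|%:R^-1 *
    \sum_u cowt j u * cost (slice A u j) (fun x => tau (upd u j x)).
Proof.
rewrite costE /=.
under eq_bigr => u _ do rewrite (sum_padj u (fun v w s => w * (if v \in A then
  2^-1 * Normc.normc (tau u - s * tau v) else 1))).
rewrite exchange_big /=; apply: eq_bigr => j _.
rewrite big_mkcond (sum_upd j) /=; congr (_ * _); apply: eq_bigr => u _.
rewrite costE mulr_sumr [RHS]big_mkcond; apply: eq_bigr => x _.
rewrite inE; case: ifP => // _; rewrite mulr_sumr upd_in.
apply: eq_bigr => y _; rewrite upd_upd cowt_upd inE.
by rewrite mulrA [_ * cowt _ _]mulrC.
Qed.

Hypothesis k_gt0 : (0 < k)%N.

Lemma cheeger_prod_ge : \sum_j cheeger (G j) <= cheeger (cart_prod G).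
Proof.
have [A [tau [A_neq0 tauS1 cA]]] := @cheeger_witness R k (cart_prod G) k_gt0.
rewrite -(ler_pM2r (vol_gt0 _ A_neq0)) -cA cost_slices mulr_suml.
(* The same volume is sliced anew for each [j], in the direction of the term it is compared with. *)
apply: ler_sum => j _; rewrite (vol_slices A j) mulrCA.
apply: ler_wpM2l; first by rewrite invr_ge0 ler0n.
rewrite mulr_sumr; apply: ler_sum => u _; rewrite mulrCA.
by apply: ler_wpM2l; rewrite ?cowt_ge0 ?cheeger_le_cost.
Qed.

Lemma cheeger_prod_le : cheeger (cart_prod G) <= \sum_j cheeger (G j).
Proof.
have [B /fin_all_exists[t Bt]] :=
  fin_all_exists (fun j => @cheeger_witness R k (G j) k_gt0).
pose A : {set cart_prod G} := [set u : pvertex G | [forall j, u j \in B j]].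
pose tau u := \prod_j t j (u j).
have tS1 j x : t j x \in S1 R k by case: (Bt j).
have A_neq0 : A != set0.
  have B_ex j : exists x, x \in B j by case: (Bt j) => /set0Pn.
  have [b bB] := fin_all_exists B_ex.
  apply/set0Pn; exists (finfun b : pvertex G); rewrite inE.
  by apply/forallP => j; rewrite ffunE.
have tauS1 u : tau u \in S1 R k by apply: S1_prod.
rewrite -(ler_pM2r (vol_gt0 _ A_neq0)).
apply: (le_trans (cheeger_le_cost A tau tauS1)).
rewrite cost_slices mulr_suml; apply: ler_sum => j _.
rewrite (vol_slices A j) mulrCA.
apply: ler_wpM2l; first by rewrite invr_ge0 ler0n.
rewrite mulr_sumr; apply: ler_sum => u _; rewrite mulrCA.
apply: ler_wpM2l; first exact: cowt_ge0.
have [uB|uNB] := boolP [forall (i | i != j), u i \in B i]; last first.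
  suff ->: slice A u j = set0 by rewrite cost0 vol0 mulr0.
  apply/setP => x; rewrite !inE; apply: contraNF uNB => /forallP xA.
  by apply/forall_inP => i ij; have := xA i; rewrite upd_out.
have ->: slice A u j = B j.
  apply/setP => x; rewrite !inE; apply/forallP/idP => [/(_ j)|xB i].
    by rewrite upd_in.
  have [->|ij] := eqVneq i j; first by rewrite upd_in.
  by rewrite upd_out //; apply: (forall_inP uB).
case: (Bt j) => _ _ <-.
(* Along a line in direction [j], [tau] is [t j] times a constant of modulus 1, which leaves the
   cost unchanged. *)
rewrite -(cost_scale (B j) (t j) (\prod_(i | i != j) t i (u i))); last first.
  exact/(@normc_S1 _ k)/S1_prod.
rewrite le_eqVlt; apply/orP; left; apply/eqP; apply: eq_cost => x.
rewrite /tau (bigD1 j) //= upd_in mulrC; congr (_ * _).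
by apply: eq_bigr => i ij; rewrite upd_out.
Qed.

End Product.

Theorem theorem4p1 (R : realType) (k m : nat) (k_gt0 : (0 < k)%N)
    (m_gt0 : (0 < m)%N) (G : 'I_m -> sgraph R k) :
  3^-1 * \sum_(j < m) cheeger (G j) <= cheeger (cart_prod G)
  /\ cheeger (cart_prod G) <= 3 * \sum_(j < m) cheeger (G j).
Proof.
have ge_h := cheeger_prod_ge G k_gt0; have le_h := cheeger_prod_le G k_gt0.
(* Nonnegativity is what makes the factors 1/3 and 3 weaken the two exact bounds. *)
have h_ge0 : 0 <= \sum_(j < m) cheeger (G j).
  by apply: sumr_ge0 => j _; apply: cheeger_ge0.
by split; lra.
Qed.
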